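(* Let $n,\ell\in\mathbb N$, let $P\in\mathcal M_{(n+1)\times(n+1)}(\mathbb R)$ be symmetric positive definite, let $\mathcal E_P^n=\{\mathrm x\in\mathbb R^{n+1}\mid\mathrm x^\top P\mathrm x=1\}$, and let $\imath_P:(\mathcal E_P^n)^\ell\hookrightarrow(\mathbb R^{n+1}\setminus\{0\})^\ell$ be the inclusion. Let $g$ be the Riemannian metric on $(\mathbb R^{n+1}\setminus\{0\})^\ell$ given by $\langle X_{\mathbf x},Y_{\mathbf x}\rangle_{g(\mathbf x)}=\sum_{i=1}^\ell Z_i(\mathbf x)\,X_{\mathrm x_i}^\top P\,Y_{\mathrm x_i}$, let $g_P=\imath_P^*g$ be the induced metric on $(\mathcal E_P^n)^\ell$, and let $V_P=V\circ\imath_P:(\mathcal E_P^n)^\ell\to\mathbb R$, where $$V(\mathbf x)=-\frac12\sum_{i,j=1}^\ell\exp(\mathrm x_i^\top P\mathrm x_j).$$ Let $Y_P$ be the vector field on $(\mathcal E_P^n)^\ell$ whose $i$-th component is $$Y_P(\mathbf y)_i=\left(\mathbb I_{n+1}-\mathrm y_i\mathrm y_i^\top P\right)\left(\sum_{j=1}^\ell\alpha_{ij}(\mathbf y)\,\mathrm y_j\right),\qquad 1\le i\le\ell.$$ Then $\mathrm{grad}_{g_P}V_P=-Y_P$.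
   Context: Points of $(\mathbb R^{n+1}\setminus\{0\})^\ell$ are written $\mathbf x=(\mathrm x_1,\dots,\mathrm x_\ell)$, tangent vectors $X_{\mathbf x}=(X_{\mathrm x_1},\dots,X_{\mathrm x_\ell})\in(\mathbb R^{n+1})^\ell$. Here $Z_i(\mathbf x)=\sqrt{n+1}\sum_{k=1}^\ell\exp(\mathrm x_i^\top P\mathrm x_k)$ and $\alpha_{ij}(\mathbf x)=\exp(\mathrm x_i^\top P\mathrm x_j)/Z_i(\mathbf x)$. The gradient of $\phi$ with respect to a metric $g$ is defined by $\mathbf d\phi(X)=\langle\mathrm{grad}_g\phi,X\rangle_g$ for every vector field $X$. *)

(* Defs.v *)
From HB Require Import structures.
From mathcomp Require Import all_boot all_order all_algebra.
From mathcomp Require Import all_classical all_reals all_analysis.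

Set Implicit Arguments.
Unset Strict Implicit.
Unset Printing Implicit Defensive.

Import Order.TTheory GRing.Theory Num.Theory.
Import numFieldNormedType.Exports.

Local Open Scope classical_set_scope.
Local Open Scope ring_scope.

Section Gradient.
Context {R : realType} {W : normedModType R}.
Implicit Types (M : set W) (phi : W -> R) (g : W -> W -> W -> R).

Definition smooth_curve (gamma : R -> W) : Prop :=
  forall (k : nat) (t : R), derivable (derive1n k gamma) t 1.

Definition curve_through M (y X : W) (gamma : R -> W) : Prop :=
  [/\ smooth_curve gamma, forall t, M (gamma t), gamma 0 = y
    & derive1 gamma 0 = X].

(* The tangent space at y of a submanifold M of W, as a set of vectors of W:
   the velocities at y of the smooth curves drawn on M. *)
Definition tangent M (y : W) : set W :=
  [set X | exists gamma, curve_through M y X gamma].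

(* Only the values of X on M are meaningful. *)
Definition vector_field M (X : W -> W) : Prop :=
  forall y, M y -> tangent M y (X y).

(* The differential at y of the restriction of phi to M maps the tangent vector
   X to c: phi has derivative c along every curve on M with velocity X at y. *)
Definition differential_at M phi (y X : W) (c : R) : Prop :=
  forall gamma, curve_through M y X gamma -> is_derive (0 : R) 1 (phi \o gamma) c.

(* G is the gradient on M of the restriction of phi to M, with respect to the
   metric that M inherits from g: phi is only evaluated at points of M, and g
   only at points of M and on vectors tangent to M. *)
Definition is_gradient M g phi (G : W -> W) : Prop :=
  vector_field M G /\
  forall X, vector_field M X ->
    forall y, M y -> differential_at M phi y (X y) (g y (G y) (X y)).

End Gradient.

(* A point (x_1, ..., x_l) of (R^(n+1))^l, or a tangent vector there, is the
   matrix whose i-th column is its i-th component. *)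
Section Attention.
Context {R : realType} {n l : nat}.
Implicit Types (P : 'M[R]_n.+1) (x y : 'M[R]_(n.+1, l)).

Definition form P (u v : 'cV[R]_n.+1) : R := (u^T *m P *m v) 0 0.

Definition posdef P : Prop := forall v : 'cV[R]_n.+1, v != 0 -> 0 < form P v v.

Definition ellipsoid P : set 'cV[R]_n.+1 := [set v | form P v v = 1].

Definition ellipsoids P : set 'M[R]_(n.+1, l) :=
  [set x | forall i, ellipsoid P (col i x)].

Definition punctured : set 'M[R]_(n.+1, l) := [set x | forall i, col i x != 0].

Lemma ellipsoids_punctured P : ellipsoids P `<=` punctured.
Proof.
move=> x xE i; apply/eqP => xi0; have := xE i.
by rewrite /ellipsoid/= /form xi0 mulmx0 mxE => /eqP; rewrite eq_sym oner_eq0.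
Qed.

Definition Zsum P x (i : 'I_l) : R :=
  Num.sqrt n.+1%:R * \sum_(k < l) expR (form P (col i x) (col k x)).

Definition alpha P x (i j : 'I_l) : R :=
  expR (form P (col i x) (col j x)) / Zsum P x i.

Definition attention_metric P x (X Y : 'M[R]_(n.+1, l)) : R :=
  \sum_(i < l) Zsum P x i * form P (col i X) (col i Y).

Definition energy P x : R :=
  - (1 / 2 * \sum_(i < l) \sum_(j < l) expR (form P (col i x) (col j x))).

Definition attention_comp P y (i : 'I_l) : 'cV[R]_n.+1 :=
  (1%:M - col i y *m (col i y)^T *m P) *m
    \sum_(j < l) alpha P y i j *: col j y.

Definition attention_field P y : 'M[R]_(n.+1, l) := \matrix_(k, i) attention_comp P y i k 0.

End Attention.

(* Main.v *)
(* Differentiating the constraint form(y_i, y_i) = 1 along a curve, and running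
   conversely along great ellipses, one identifies the tangent space at y as
   { X | form(y_i, X_i) = 0 for all i }. For such X the symmetry of the double
   sum gives dV(X) = - sum_ij exp(form(y_i, y_j)) form(y_j, X_i), which is
   - g(Y_P, X) because the normal part of Y_P is orthogonal to X and the
   weights Z_i cancel the denominators of alpha_ij. Conversely, a gradient G
   makes W = G + Y_P tangent with g(W, W) = 0, and g is positive definite. *)

Require Import Defs.
From HB Require Import structures.
From mathcomp Require Import all_boot all_order all_algebra.
From mathcomp Require Import all_classical all_reals all_analysis.
From mathcomp Require Import ring.
Import Order.TTheory GRing.Theory Num.Theory.
Import numFieldNormedType.Exports.
Local Open Scope classical_set_scope.
Local Open Scope ring_scope.

Set Implicit Arguments.
Unset Strict Implicit.
Unset Printing Implicit Defensive.

(* Unqualified, [form] is the one of mathcomp's sesquilinear.v. *)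
Local Notation form := Defs.form.

(** * Derivatives of matrix-valued maps and of finite sums *)

Lemma is_derive_mxP {R : realFieldType} {V : normedModType R} {m n : nat}
    (M : V -> 'M[R]_(m, n)) t v (dM : 'M[R]_(m, n)) :
  is_derive t v M dM <->
  forall i j, is_derive t v (fun x => M x i j) (dM i j).
Proof.
split=> [[dM1 <-] i j|dM1].
  split; first by move/derivable_mxP: dM1; apply.
  by rewrite derive_mx// mxE.
have DM : derivable M t v by apply/derivable_mxP => i j; have [] := dM1 i j.
split=> //; rewrite derive_mx//; apply/matrixP => i j; rewrite mxE.
by have [] := dM1 i j.
Qed.

Lemma is_derive_bigsum {R : numFieldType} {V W : normedModType R} (m : nat)
    (h : 'I_m -> V -> W) (x v : V) (dh : 'I_m -> W) :
  (forall i, is_derive x v (h i) (dh i)) ->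
  is_derive x v (fun t => \sum_(i < m) h i t) (\sum_(i < m) dh i).
Proof.
move=> dhi; rewrite (_ : (fun _ => _) = \sum_(i < m) h i).
  exact: is_derive_sum.
by apply/funext => t; rewrite fct_sumE.
Qed.

(** * The bilinear form of [P] and its product rule *)

Section Form.
Context {R : realType} {n : nat}.
Implicit Types (P : 'M[R]_n.+1) (u v w : 'cV[R]_n.+1).

Lemma formE P u v : form P u v = \sum_i \sum_j u i 0 * P i j * v j 0.
Proof.
rewrite /form mxE exchange_big/=; apply: eq_bigr => j _.
rewrite mxE mulr_suml; apply: eq_bigr => i _.
by rewrite mxE.
Qed.

Lemma formC P u v : P^T = P -> form P u v = form P v u.
Proof.
move=> P_sym; have /matrixP/(_ 0 0) : (u^T *m P *m v)^T = v^T *m P *m u.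
  by rewrite !trmx_mul trmxK P_sym mulmxA.
by rewrite mxE.
Qed.

Lemma formDl P u v w : form P (u + v) w = form P u w + form P v w.
Proof. by rewrite /form linearD/= !mulmxDl mxE. Qed.

Lemma formZl P a u v : form P (a *: u) v = a * form P u v.
Proof. by rewrite /form linearZ/= -!scalemxAl mxE. Qed.

Lemma formNl P u v : form P (- u) v = - form P u v.
Proof. by rewrite -scaleN1r formZl mulN1r. Qed.

Lemma form0l P u : form P 0 u = 0.
Proof. by rewrite /form trmx0 !mul0mx mxE. Qed.

Lemma form_suml P m (F : 'I_m -> 'cV_n.+1) v :
  form P (\sum_i F i) v = \sum_i form P (F i) v.
Proof.
elim/big_rec2: _ => [|i a u _ <-]; first exact: form0l.
by rewrite formDl.
Qed.

Lemma formDr P u v w : form P u (v + w) = form P u v + form P u w.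
Proof. by rewrite /form mulmxDr mxE. Qed.

Lemma formZr P a u v : form P u (a *: v) = a * form P u v.
Proof. by rewrite /form -scalemxAr mxE. Qed.

Lemma formNr P u v : form P u (- v) = - form P u v.
Proof. by rewrite -scaleN1r formZr mulN1r. Qed.

Lemma form0r P u : form P u 0 = 0.
Proof. by rewrite /form mulmx0 mxE. Qed.

Lemma posdef_ge0 P u : posdef P -> 0 <= form P u u.
Proof.
by move=> P_pos; have [->|/P_pos/ltW//] := eqVneq u 0; rewrite form0l.
Qed.

(** Expanded in entries, the form is a finite sum of products of two scalar functions, so the scalar
    product rule applies termwise. *)
Lemma is_derive_form P (u v : R -> 'cV[R]_n.+1) (t : R) (du dv : 'cV[R]_n.+1) :
  is_derive t 1 u du -> is_derive t 1 v dv ->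
  is_derive t 1 (fun s => form P (u s) (v s))
    (form P du (v t) + form P (u t) dv).
Proof.
move=> /is_derive_mxP du1 /is_derive_mxP dv1.
under eq_fun do rewrite formE.
rewrite !formE -big_split/=; apply: is_derive_bigsum => i.
rewrite -big_split/=; apply: is_derive_bigsum => j.
have := du1 i 0; have := dv1 j 0; set f := fun x => v x j 0.
set g := fun x => u x i 0 => df dg.
rewrite (_ : (fun _ => _) = P i j \*: (g * f)); last first.
  by apply/funext => s; rewrite /= mulrfctE /f /g [u s i 0 * _]mulrC -mulrA.
apply: is_derive_eq; rewrite /f /g/= /GRing.scale/=; ring.
Qed.

End Form.

(** * Curves on the product of ellipsoids and its tangent spaces *)

Section Ellipsoids.
Context {R : realType} {n l : nat}.
Variable P : 'M[R]_n.+1.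
Hypothesis P_sym : P^T = P.
Implicit Types (x y X : 'M[R]_(n.+1, l)).

Lemma is_derive_col (gamma : R -> 'M[R]_(n.+1, l)) (t : R) X i :
  is_derive t 1 gamma X -> is_derive t 1 (fun s => col i (gamma s)) (col i X).
Proof.
move=> /is_derive_mxP dgamma; apply/is_derive_mxP => a b; rewrite mxE.
by under eq_fun do rewrite mxE; exact: dgamma.
Qed.

Lemma curve_through_is_derive (M : set 'M[R]_(n.+1, l)) y X gamma :
  curve_through M y X gamma -> is_derive (0 : R) 1 gamma X.
Proof.
case=> smooth _ _ <-; rewrite derive1E; apply: derivableP.
(* [derive1n 0 gamma] is [gamma] itself, so order 0 of smoothness already gives its derivability. *)
exact: (smooth 0%N 0).
Qed.

(** Each column runs on its own ellipse with its own angular speed. Leaving both coefficient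
    matrices free makes the family closed under differentiation. *)
Definition harmonic (a : 'I_l -> R) (A B : 'M[R]_(n.+1, l)) (t : R) :
    'M[R]_(n.+1, l) :=
  \matrix_(k, i) (cos (t * a i) * A k i + sin (t * a i) * B k i).

Lemma is_derive_harmonic a A B (t : R) :
  is_derive t 1 (harmonic a A B)
    (harmonic a (\matrix_(k, i) (a i * B k i))
                (\matrix_(k, i) (- a i * A k i)) t).
Proof.
apply/is_derive_mxP => k i; rewrite mxE.
under eq_fun do rewrite mxE.
have lin : is_derive t 1 (fun s : R => s * a i) (a i).
  rewrite (_ : (fun _ => _) = a i \*: id); last first.
    by apply/funext => s /=; rewrite mulrC.
  by apply: is_derive_eq; rewrite /GRing.scale/= mulr1.
rewrite (_ : (fun _ => _) = A k i \*: (cos \o (fun s : R => s * a i)) +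
                            B k i \*: (sin \o (fun s : R => s * a i))); last first.
  by apply/funext => s; rewrite fctE/= [cos _ * _]mulrC [sin _ * _]mulrC.
apply: is_derive_eq; rewrite !mxE /GRing.scale/=; ring.
Qed.

(** Differentiating only changes the coefficients to [a B] and [- a A] columnwise, whence an
    induction on the order with [A] and [B] generalised. *)
Lemma smooth_harmonic a A B : smooth_curve (harmonic a A B).
Proof.
move=> k; elim: k => [|k IHk] in A B * => t.
  by have [] := is_derive_harmonic a A B t.
rewrite derive1Sn.
rewrite (_ : derive1 _ = harmonic a (\matrix_(k, i) (a i * B k i))
                                    (\matrix_(k, i) (- a i * A k i))) //.
apply/funext => s; rewrite derive1E.
by have [] := is_derive_harmonic a A B s.
Qed.

Lemma tangent_ellipsoidsP y X : posdef P -> ellipsoids P y ->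
  tangent (ellipsoids P) y X <-> forall i, form P (col i y) (col i X) = 0.
Proof.
move=> P_pos yE; split=> [[gamma gammaX] i|orth].
  have dgamma := curve_through_is_derive gammaX.
  have [_ gammaE gamma0 _] := gammaX.
  have dcol := is_derive_col i dgamma.
  have [_] := is_derive_form P dcol dcol.
  under eq_fun do rewrite gammaE.
  rewrite (derive_cst (1 : R)) gamma0 (formC _ (col i X)) //.
  by move/esym/eqP; rewrite -mulr2n mulrn_eq0/= => /eqP.
(* The i-th component of the curve is cos (a t) y_i + sin (a t) X_i / a with
   a = |X_i|_P; when X_i = 0 the junk value 0^-1 = 0 makes it constant. *)
pose a i := Num.sqrt (form P (col i X) (col i X)).
(* Definiteness of [P] is what gives the constant component the right velocity, namely zero. *)
have X0 i : a i = 0 -> col i X = 0.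
  move=> /eqP; rewrite sqrtr_eq0 => ai0; apply/eqP/negPn/negP => /P_pos.
  by rewrite ltNge ai0.
pose B : 'M[R]_(n.+1, l) := \matrix_(k, i) ((a i)^-1 * X k i).
exists (harmonic a y B); split.
- exact: smooth_harmonic.
- move=> t i; rewrite /ellipsoid/=.
  have -> : col i (harmonic a y B t) =
      cos (t * a i) *: col i y + (sin (t * a i) * (a i)^-1) *: col i X.
    by apply/matrixP => k j; rewrite !mxE mulrA.
  rewrite !(formDl, formDr, formZl, formZr) (formC (col i X) (col i y)) //.
  rewrite orth (yE i : form _ _ _ = 1).
  have -> : form P (col i X) (col i X) = a i ^+ 2.
    by rewrite sqr_sqrtr// posdef_ge0.
  have [ai0|ai0] := eqVneq (a i) 0.
    by rewrite ai0 mulr0 cos0 sin0 expr0n/=; ring.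
  rewrite -[RHS](cos2Dsin2 (t * a i)); field.
  exact: ai0.
- apply/matrixP => k i; rewrite !mxE !mul0r cos0 sin0; ring.
- rewrite derive1E; have [_ ->] := is_derive_harmonic a y B 0.
  apply/matrixP => k i; rewrite !mxE mul0r cos0 sin0 mul0r addr0 mul1r.
  have [ai0|ai0] := eqVneq (a i) 0; last by rewrite mulrA divff// mul1r.
  by move/matrixP/(_ k 0): (X0 i ai0); rewrite ai0 mul0r !mxE.
Qed.

(** * The derivative of the energy along a curve *)

Lemma is_derive_energy (gamma : R -> 'M[R]_(n.+1, l)) (t : R) X :
  is_derive t 1 gamma X ->
  is_derive t 1 (energy P \o gamma)
    (- \sum_i \sum_j expR (form P (col i (gamma t)) (col j (gamma t))) *
                     form P (col j (gamma t)) (col i X)).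
Proof.
move=> dgamma; pose e i j s := form P (col i (gamma s)) (col j (gamma s)).
have de i j : is_derive t 1 (e i j) (form P (col i X) (col j (gamma t)) +
                                     form P (col i (gamma t)) (col j X)).
  by apply: is_derive_form; exact: is_derive_col.
rewrite (_ : _ \o _ = - ((1 / 2) \*: (fun s => \sum_i \sum_j (expR \o e i j) s))) //.
have := is_derive_bigsum (fun i => is_derive_bigsum (fun j =>
  is_derive1_comp (is_derive_expR (e i j t)) (de i j))).
move=> dS; apply: is_derive_eq; congr (- _).
pose S := \sum_i \sum_j expR (e i j t) * form P (col j (gamma t)) (col i X).
(* Exchanging [i] and [j] in the second product-rule term and using the symmetry of [P] turns it
   into the first; the factor 1/2 then cancels. *)
have -> : \sum_i \sum_j expR (e i j t) * (form P (col i X) (col j (gamma t)) +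
    form P (col i (gamma t)) (col j X)) = S + S.
  rewrite {2}/S [in RHS]exchange_big /S -big_split/=; apply: eq_bigr => i _.
  rewrite -big_split/=; apply: eq_bigr => j _.
  by rewrite mulrDr (formC (col i X)) // [e j i t]formC.
by rewrite -/S /GRing.scale/=; field.
Qed.

(** * The attention field paired with the metric *)

Lemma col_attention_field y i :
  col i (attention_field P y) =
  \sum_j alpha P y i j *: col j y -
  form P (col i y) (\sum_j alpha P y i j *: col j y) *: col i y.
Proof.
have -> : col i (attention_field P y) = attention_comp P y i.
  by apply/matrixP => k j; rewrite !mxE ord1.
rewrite /attention_comp mulmxBl mul1mx -!mulmxA.
(* For a column [v], the product of [y_i^T], [P] and [v] is a 1 by 1 matrix, hence acts as the
   scalar [form P y_i v]. *)
by rewrite [_^T *m _]mx11_scalar mul_mx_scalar mulmxA.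
Qed.

Lemma Zsum_gt0 y (i : 'I_l) : 0 < Zsum P y i.
Proof.
rewrite mulr_gt0 ?sqrtr_gt0 ?ltr0Sn// (bigD1 i)//= ltr_pwDl ?expR_gt0//.
by apply: sumr_ge0 => j _; exact: expR_ge0.
Qed.

Lemma attention_field_tangent y i : ellipsoids P y ->
  form P (col i y) (col i (attention_field P y)) = 0.
Proof.
move=> yE; rewrite col_attention_field formDr formNr formZr.
by rewrite (yE i : form _ _ _ = 1) mulr1 subrr.
Qed.

Lemma attention_metric_field y X :
  (forall i, form P (col i y) (col i X) = 0) ->
  attention_metric P y (attention_field P y) X =
  \sum_i \sum_j expR (form P (col i y) (col j y)) * form P (col j y) (col i X).
Proof.
move=> orth; apply: eq_bigr => i _.
rewrite col_attention_field formDl formNl formZl orth mulr0 subr0.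
rewrite form_suml mulr_sumr; apply: eq_bigr => j _.
by rewrite formZl mulrA /alpha [Zsum _ _ _ * _]mulrC divfK ?gt_eqF ?Zsum_gt0.
Qed.

Lemma attention_metricDl y X Y Z : attention_metric P y (X + Y) Z =
  attention_metric P y X Z + attention_metric P y Y Z.
Proof.
rewrite -big_split; apply: eq_bigr => i _.
by rewrite linearD formDl mulrDr.
Qed.

Lemma attention_metricNl y X Z :
  attention_metric P y (- X) Z = - attention_metric P y X Z.
Proof.
by rewrite -sumrN; apply: eq_bigr => i _; rewrite linearN formNl mulrN.
Qed.

(** A vanishing sum of nonnegative terms vanishes termwise; the weights are positive, so
    definiteness of [P] kills each column. *)
Lemma attention_metric_eq0 y X : posdef P ->
  attention_metric P y X X = 0 -> X = 0.
Proof.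
move=> P_pos /eqP.
rewrite psumr_eq0 => [|i _]; last
  by rewrite mulr_ge0 ?posdef_ge0// ltW// Zsum_gt0.
move=> /allP/= X0; apply/matrixP => k i.
have /X0 : i \in index_enum 'I_l by rewrite mem_index_enum.
rewrite mulf_eq0 gt_eqF ?Zsum_gt0//= => formX0.
have /matrixP/(_ k 0) : col i X = 0; last by rewrite !mxE.
by apply/eqP/negPn/negP => /P_pos; rewrite (eqP formX0) ltxx.
Qed.

End Ellipsoids.

Theorem theorem3p1 (R : realType) (n l : nat) (P : 'M[R]_n.+1)
    (P_sym : P^T = P) (P_pos : posdef P)
    (G : 'M[R]_(n.+1, l) -> 'M[R]_(n.+1, l)) :
  is_gradient (ellipsoids P) (attention_metric P) (energy P) G <->
  (forall y, ellipsoids P y -> G y = - attention_field P y).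
Proof.
(* Shared by both directions: the derivative of the energy depends on the curve only through its
   point and velocity at 0. *)
have denergy (y : 'M[R]_(n.+1, l)) X gamma : ellipsoids P y ->
    curve_through (ellipsoids P) y X gamma ->
    is_derive (0 : R) 1 (energy P \o gamma)
      (- attention_metric P y (attention_field P y) X).
  move=> yE gammaX; have [_ _ gamma0 _] := gammaX.
  rewrite attention_metric_field; last first.
    by apply/(tangent_ellipsoidsP P_sym X P_pos yE); exists gamma.
  rewrite -gamma0; apply: is_derive_energy => //.
  exact: curve_through_is_derive gammaX.
split=> [[Gtan dG] y yE|GE]; last first.
  split=> [y yE|X Xtan y yE gamma gammaX]; rewrite GE//.
    apply/tangent_ellipsoidsP => // i.
    by rewrite linearN formNr attention_field_tangent// oppr0.
  by rewrite attention_metricNl; exact: denergy gammaX.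
pose W := G y + attention_field P y.
have Worth i : form P (col i y) (col i W) = 0.
  rewrite linearD formDr attention_field_tangent// addr0.
  by have /(tangent_ellipsoidsP P_sym _ P_pos yE) := Gtan y yE.
(* Gradients are tested against whole vector fields, so the single vector [W] is extended by zero;
   [vector_field] asks only for tangency at each point. *)
have Wtan : vector_field (ellipsoids P) (fun z => if z == y then W else 0).
  move=> z zE; apply/tangent_ellipsoidsP => // i.
  by case: eqP => [->//|_]; rewrite linear0 form0r.
have [gamma gammaW] : tangent (ellipsoids P) y W by apply/tangent_ellipsoidsP.
have dGW : is_derive (0 : R) 1 (energy P \o gamma) (attention_metric P y (G y) W).
  by have := dG _ Wtan y yE gamma; rewrite eqxx; apply.
(* Both sides are the derivative of the energy along the same [gamma], which is unique. *)
have metricE : attention_metric P y (G y) W =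
    - attention_metric P y (attention_field P y) W.
  by have [_ <-] := dGW; have [_ ->] := denergy y W gamma yE gammaW.
apply/eqP; rewrite -addr_eq0; apply/eqP.
apply: (attention_metric_eq0 (y := y) P_pos).
by rewrite attention_metricDl -/W metricE addNr.
Qed.
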